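(* Let $(A,P_A,Q_A)$, $(B,P_B,Q_B)$, $(C,P_C,Q_C)$ be finite strict double posets. Then $$\#\{f\in\mathrm{Mor}((A,P_A,Q_A),(B,P_B,Q_B)):(f(A),P_B\cap(f(A)\times f(A)),Q_B\cap(f(A)\times f(A)))\cong(C,P_C,Q_C)\}$$ $$=\frac{|\mathrm{Epi}((A,P_A,Q_A),(C,P_C,Q_C))|\cdot|\mathrm{RegMono}((C,P_C,Q_C),(B,P_B,Q_B))|}{|\mathrm{Aut}((C,P_C,Q_C))|},$$ and $$\#\{f\in\mathrm{Mor}((A,P_A,Q_A),(B,P_B,Q_B)):(f(A),\mathrm{Tr}(f(P_A)),\mathrm{Tr}(f(Q_A)))\cong(C,P_C,Q_C)\}$$ $$=\frac{|\mathrm{RegEpi}((A,P_A,Q_A),(C,P_C,Q_C))|\cdot|\mathrm{Mono}((C,P_C,Q_C),(B,P_B,Q_B))|}{|\mathrm{Aut}((C,P_C,Q_C))|}.$$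
   Context: A finite strict double poset is a triple $(A,P_A,Q_A)$ with $A$ finite and $P_A,Q_A$ strict partial orders; morphisms are maps preserving both strict orders, forming a category. $\mathrm{Mor},\mathrm{Mono},\mathrm{Epi},\mathrm{Aut}$ denote morphisms, monomorphisms, epimorphisms, automorphisms; $\mathrm{RegMono}$ regular monomorphisms (equalizers of some parallel pair), $\mathrm{RegEpi}$ regular epimorphisms (coequalizers of some parallel pair). For a map $f$ and a relation $R$, $f(R)=\{(f(a),f(a')):(a,a')\in R\}$, and $\mathrm{Tr}(R)$ denotes the transitive closure of $R$. *)

(* Defs.v *)
From HB Require Import structures.
From Stdlib Require Import Relation_Operators.
From mathcomp Require Import all_boot all_order all_algebra.
From mathcomp Require Import boolp.

Set Implicit Arguments.
Unset Strict Implicit.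
Unset Printing Implicit Defensive.

Definition strict_order (T : Type) (R : rel T) : Prop :=
  irreflexive R /\ transitive R.

Record dposet := DPoset {
  dp_car :> finType;
  dpP : rel dp_car;
  dpQ : rel dp_car;
  dpP_strict : strict_order dpP;
  dpQ_strict : strict_order dpQ }.

Arguments dpP : clear implicits.
Arguments dpQ : clear implicits.

Definition preserves (T U : finType) (R : rel T) (S : rel U) (f : T -> U) : bool :=
  [forall x, forall y, R x y ==> S (f x) (f y)].

(* Morphisms are finite functions with a boolean side condition, so that
   Leibniz equality is pointwise equality and Mor(A, B) is a finType. *)
Record dpmor (A B : dposet) := DPMor {
  dpmor_fun : {ffun A -> B};
  dpmorP : preserves (dpP A) (dpP B) dpmor_fun
           && preserves (dpQ A) (dpQ B) dpmor_fun }.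

Definition dpmor_apply (A B : dposet) (f : dpmor A B) : A -> B := dpmor_fun f.
Coercion dpmor_apply : dpmor >-> Funclass.

HB.instance Definition _ (A B : dposet) := [isSub for @dpmor_fun A B].
HB.instance Definition _ (A B : dposet) := [Finite of dpmor A B by <:].

Lemma preservesP (T U : finType) (R : rel T) (S : rel U) (f : T -> U) :
  reflect (forall x y, R x y -> S (f x) (f y)) (preserves R S f).
Proof.
apply: (iffP 'forall_forallP) => h x y; last by apply/implyP/h.
by apply/implyP/h.
Qed.

Lemma dpmor_P (A B : dposet) (f : dpmor A B) (x y : A) :
  dpP A x y -> dpP B (f x) (f y).
Proof. by case/andP: (dpmorP f) => /preservesP h _; apply: h. Qed.

Lemma dpmor_Q (A B : dposet) (f : dpmor A B) (x y : A) :
  dpQ A x y -> dpQ B (f x) (f y).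
Proof. by case/andP: (dpmorP f) => _ /preservesP h; apply: h. Qed.

Lemma dpid_subproof (A : dposet) :
  preserves (dpP A) (dpP A) [ffun x : A => x]
  && preserves (dpQ A) (dpQ A) [ffun x : A => x].
Proof. by apply/andP; split; apply/preservesP => x y; rewrite !ffunE. Qed.

Definition dpid (A : dposet) : dpmor A A := DPMor (dpid_subproof A).

Lemma dpcomp_subproof (A B C : dposet) (g : dpmor B C) (f : dpmor A B) :
  preserves (dpP A) (dpP C) [ffun x : A => g (f x)]
  && preserves (dpQ A) (dpQ C) [ffun x : A => g (f x)].
Proof.
apply/andP; split; apply/preservesP => x y; rewrite !ffunE => h.
  by do 2!apply: dpmor_P.
by do 2!apply: dpmor_Q.
Qed.

Definition dpcomp (A B C : dposet) (g : dpmor B C) (f : dpmor A B) : dpmor A C :=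
  DPMor (dpcomp_subproof g f).

Definition is_mono (A B : dposet) (f : dpmor A B) : Prop :=
  forall (D : dposet) (g h : dpmor D A), dpcomp f g = dpcomp f h -> g = h.

Definition is_epi (A B : dposet) (f : dpmor A B) : Prop :=
  forall (D : dposet) (g h : dpmor B D), dpcomp g f = dpcomp h f -> g = h.

Definition is_iso (A B : dposet) (f : dpmor A B) : Prop :=
  exists g : dpmor B A, dpcomp g f = dpid A /\ dpcomp f g = dpid B.

Definition dp_isomorphic (A B : dposet) : Prop :=
  exists f : dpmor A B, is_iso f.

Definition is_equalizer (A B D : dposet) (g h : dpmor B D) (f : dpmor A B) : Prop :=
  dpcomp g f = dpcomp h f /\
  forall (E : dposet) (k : dpmor E B), dpcomp g k = dpcomp h k ->
    exists! u : dpmor E A, dpcomp f u = k.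

Definition is_coequalizer (A B D : dposet) (g h : dpmor D A) (f : dpmor A B) : Prop :=
  dpcomp f g = dpcomp f h /\
  forall (E : dposet) (k : dpmor A E), dpcomp k g = dpcomp k h ->
    exists! u : dpmor B E, dpcomp u f = k.

Definition is_regmono (A B : dposet) (f : dpmor A B) : Prop :=
  exists (D : dposet) (g h : dpmor B D), is_equalizer g h f.

Definition is_regepi (A B : dposet) (f : dpmor A B) : Prop :=
  exists (D : dposet) (g h : dpmor D A), is_coequalizer g h f.

Definition Mono (A B : dposet) : {set dpmor A B} := [set f | `[< is_mono f >]].
Definition Epi (A B : dposet) : {set dpmor A B} := [set f | `[< is_epi f >]].
Definition RegMono (A B : dposet) : {set dpmor A B} := [set f | `[< is_regmono f >]].
Definition RegEpi (A B : dposet) : {set dpmor A B} := [set f | `[< is_regepi f >]].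
Definition Aut (A : dposet) : {set dpmor A A} := [set f | `[< is_iso f >]].

Definition im_rel (T U : finType) (f : T -> U) (R : rel T) : rel U :=
  [rel u v | [exists x, exists y, [&& R x y, u == f x & v == f y]]].

Definition Tr (T : Type) (R : rel T) : rel T :=
  [rel x y | `[< clos_trans T R x y >]].

Definition image_type (A B : dposet) (f : dpmor A B) : finType :=
  {b : B | b \in codom f}.

Lemma strict_relpre (T U : Type) (f : T -> U) (R : rel U) :
  strict_order R -> strict_order (relpre f R).
Proof. by case=> irR trR; split=> [x|y x z] /=; [exact: irR | exact: trR]. Qed.

Lemma strict_Tr (T : Type) (R S : rel T) :
  strict_order S -> subrel R S -> strict_order (Tr R).
Proof.
case=> irS trS sRS.
have sub u v : clos_trans T R u v -> S u v.
  elim=> {u v} [u v Ruv|u v w _ Suv _ Svw]; first exact: sRS.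
  exact: trS Suv Svw.
split=> [x|y x z] /=.
  by apply/negP => /asboolP /sub; rewrite irS.
move=> /asboolP hxy /asboolP hyz; apply/asboolP; exact: t_trans hxy hyz.
Qed.

Lemma im_rel_sub (T U : finType) (f : T -> U) (R : rel T) (S : rel U) :
  (forall x y, R x y -> S (f x) (f y)) -> subrel (im_rel f R) S.
Proof.
by move=> h u v /existsP[x /existsP[y /and3P[Rxy /eqP-> /eqP->]]]; exact: h.
Qed.

Definition image_induced (A B : dposet) (f : dpmor A B) : dposet :=
  @DPoset (image_type f) (relpre val (dpP B)) (relpre val (dpQ B))
    (strict_relpre val (dpP_strict B)) (strict_relpre val (dpQ_strict B)).

(* Tr (im_rel f R) only relates elements of f(A), so restricting it to the
   subtype f(A) loses nothing. *)
Definition image_generated (A B : dposet) (f : dpmor A B) : dposet :=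
  @DPoset (image_type f)
    (relpre val (Tr (im_rel f (dpP A)))) (relpre val (Tr (im_rel f (dpQ A))))
    (strict_relpre val (strict_Tr (dpP_strict B) (im_rel_sub (@dpmor_P A B f))))
    (strict_relpre val (strict_Tr (dpQ_strict B) (im_rel_sub (@dpmor_Q A B f)))).

(* Main.v *)
Require Import Defs.
From HB Require Import structures.
From Stdlib Require Import Relation_Operators.
From mathcomp Require Import all_boot all_order all_algebra.
From mathcomp Require Import boolp.
Import GRing.Theory.
Local Open Scope ring_scope.

Set Implicit Arguments.
Unset Strict Implicit.
Unset Printing Implicit Defensive.

(** Epimorphisms are the surjections and monomorphisms the injections; a
regular monomorphism is an injection that reflects both orders, and a regular
epimorphism is a surjection [f] whose target orders are generated by the images
under [f] of the source orders.  Both (Epi, RegMono) and (RegEpi, Mono) have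
unique diagonal fill-ins, so the factorizations [m \o e] through [C] of a given
morphism form a torsor under [Aut C].  The morphisms admitting one are those
whose image, with the induced, resp. generated, orders, is isomorphic to [C];
counting the pairs [(e, m)] along [m \o e] gives both formulas. *)

Definition surjective (T U : Type) (f : T -> U) : Prop :=
  forall y, exists x, f x = y.

Definition reflecting (A B : dposet) (f : dpmor A B) : Prop :=
  (forall x y, dpP B (f x) (f y) -> dpP A x y) /\
  (forall x y, dpQ B (f x) (f y) -> dpQ A x y).

Definition generating (A B : dposet) (f : dpmor A B) : Prop :=
  (forall x y, dpP B x y -> clos_trans B (im_rel f (dpP A)) x y) /\
  (forall x y, dpQ B x y -> clos_trans B (im_rel f (dpQ A)) x y).

(** * Morphisms *)

Lemma dpmor_ext (A B : dposet) (f g : dpmor A B) : f =1 g -> f = g.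
Proof. by move=> fg; apply/val_inj/ffunP. Qed.

Lemma dpcompE (A B C : dposet) (g : dpmor B C) (f : dpmor A B) x :
  dpcomp g f x = g (f x).
Proof. by rewrite /dpcomp /dpmor_apply /= ffunE. Qed.

Lemma dpidE (A : dposet) (x : A) : dpid A x = x.
Proof. by rewrite /dpid /dpmor_apply /= ffunE. Qed.

Lemma dpcompA (A B C D : dposet) (h : dpmor C D) (g : dpmor B C)
    (f : dpmor A B) : dpcomp h (dpcomp g f) = dpcomp (dpcomp h g) f.
Proof. by apply: dpmor_ext => x; rewrite !dpcompE. Qed.

Lemma dpcomp1f (A B : dposet) (f : dpmor A B) : dpcomp (dpid B) f = f.
Proof. by apply: dpmor_ext => x; rewrite dpcompE dpidE. Qed.

Lemma dpcompf1 (A B : dposet) (f : dpmor A B) : dpcomp f (dpid A) = f.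
Proof. by apply: dpmor_ext => x; rewrite dpcompE dpidE. Qed.

(** The result is a sigma type over pointwise equality, so that later constructions never unfold
    finite functions. *)
Lemma dpmor_of (A B : dposet) (f : A -> B) :
    (forall x y, dpP A x y -> dpP B (f x) (f y)) ->
    (forall x y, dpQ A x y -> dpQ B (f x) (f y)) ->
  {g : dpmor A B | g =1 f}.
Proof.
move=> fP fQ; suff fPQ : preserves (dpP A) (dpP B) (finfun f)
    && preserves (dpQ A) (dpQ B) (finfun f).
  by exists (DPMor fPQ) => x; rewrite /dpmor_apply /= ffunE.
by apply/andP; split; apply/preservesP => x y; rewrite !ffunE; auto.
Qed.

Lemma dpcomp_eq (A B C D : dposet) (g : dpmor B C) (f : dpmor A B)
    (h : dpmor D C) (k : dpmor A D) :
  dpcomp g f = dpcomp h k -> forall x, g (f x) = h (k x).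
Proof. by move=> e x; rewrite -!dpcompE e. Qed.

Lemma surj_epi (A B : dposet) (f : dpmor A B) : surjective f -> is_epi f.
Proof.
move=> sf D g h /dpcomp_eq gh; apply: dpmor_ext => y.
by case: (sf y) => x <-.
Qed.

Lemma inj_mono (A B : dposet) (f : dpmor A B) : injective f -> is_mono f.
Proof.
by move=> jf D g h /dpcomp_eq gh; apply: dpmor_ext => y; apply: jf.
Qed.

Lemma surjective_comp (A B C : dposet) (g : dpmor B C) (f : dpmor A B) :
  surjective g -> surjective f -> surjective (dpcomp g f).
Proof.
move=> sg sf z; case: (sg z) => y <-; case: (sf y) => x <-.
by exists x; rewrite dpcompE.
Qed.

Lemma injective_comp (A B C : dposet) (g : dpmor B C) (f : dpmor A B) :
  injective g -> injective f -> injective (dpcomp g f).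
Proof. by move=> jg jf x y; rewrite !dpcompE => /jg/jf. Qed.

Lemma reflecting_comp (A B C : dposet) (g : dpmor B C) (f : dpmor A B) :
  reflecting g -> reflecting f -> reflecting (dpcomp g f).
Proof.
by move=> [gP gQ] [fP fQ]; split=> x y; rewrite !dpcompE => h; auto.
Qed.

(** * Isomorphisms *)

Lemma iso_surj (A B : dposet) (f : dpmor A B) : is_iso f -> surjective f.
Proof.
by case=> g [_ fg] y; exists (g y); rewrite -dpcompE fg dpidE.
Qed.

Lemma iso_inj (A B : dposet) (f : dpmor A B) : is_iso f -> injective f.
Proof.
case=> g [gf _]; apply: (can_inj (g := g)) => x.
by rewrite -dpcompE gf dpidE.
Qed.

Lemma iso_reflecting (A B : dposet) (f : dpmor A B) :
  is_iso f -> reflecting f.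
Proof.
case=> g [gf _]; have fK x : g (f x) = x by rewrite -dpcompE gf dpidE.
by split=> x y; [move/(dpmor_P g) | move/(dpmor_Q g)]; rewrite !fK.
Qed.

Lemma iso_inverse (A B : dposet) (f : dpmor A B) :
  is_iso f -> exists2 g : dpmor B A, is_iso g &
    dpcomp g f = dpid A /\ dpcomp f g = dpid B.
Proof. by case=> g [gf fg]; exists g => //; exists f. Qed.

(** A bijective morphism need not be invertible: reflection is what makes the set-theoretic inverse
    preserve both orders. *)
Lemma bij_reflecting_iso (A B : dposet) (f : dpmor A B) :
  surjective f -> injective f -> reflecting f -> is_iso f.
Proof.
move=> /choice[g fg] jf [rP rQ].
have [h hE] : {h : dpmor B A | h =1 g}.
  by apply: dpmor_of => x y xy; [apply: rP | apply: rQ]; rewrite !fg.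
exists h; split; apply: dpmor_ext => x; rewrite dpcompE dpidE hE //.
by apply: jf; rewrite fg.
Qed.

Lemma dpid_iso (A : dposet) : is_iso (dpid A).
Proof. by exists (dpid A); rewrite dpcomp1f. Qed.

(** * Generated orders *)

Lemma clos_trans_im_comp (T U V : finType) (R : rel T) (e : T -> U)
    (m : U -> V) (f : T -> V) u v : (forall x, f x = m (e x)) ->
  clos_trans U (im_rel e R) u v -> clos_trans V (im_rel f R) (m u) (m v).
Proof.
move=> fE; elim=> {u v} [u v|u v w _ uv _ vw]; last exact: t_trans uv vw.
case/existsP=> x /existsP[y /and3P[xy /eqP-> /eqP->]]; apply: t_step.
by apply/existsP; exists x; apply/existsP; exists y; rewrite xy !fE !eqxx.
Qed.

(** Every value of [f] is a value of [m], so a chain for [f] lifts step by step along [m];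
    injectivity makes consecutive lifts agree at their common point. *)
Lemma clos_trans_im_inj (T U V : finType) (R : rel T) (e : T -> U)
    (m : U -> V) (f : T -> V) u v : (forall x, f x = m (e x)) ->
    injective m ->
  clos_trans V (im_rel f R) (m u) (m v) -> clos_trans U (im_rel e R) u v.
Proof.
move=> fE jm.
(* The induction needs arbitrary endpoints, so that they have lifts becomes part of the claim. *)
suff lift w z : clos_trans V (im_rel f R) w z ->
    exists u' v', [/\ w = m u', z = m v' & clos_trans U (im_rel e R) u' v'].
  by case/lift => u' [v' [/jm-> /jm->]].
elim=> {w z} [w z|w z t _ [a [b [-> -> ab]]] _ [c [d [/jm bc -> cd]]]].
  case/existsP=> x /existsP[y /and3P[xy /eqP-> /eqP->]].
  exists (e x), (e y); split; rewrite ?fE //; apply: t_step.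
  by apply/existsP; exists x; apply/existsP; exists y; rewrite xy !eqxx.
by exists a, d; split=> //; rewrite -bc in cd; apply: t_trans ab cd.
Qed.

(** To preserve a generated order it suffices to preserve the generating pairs, because the target
    relation is transitive. *)
Lemma clos_trans_im_sub (T U V : finType) (R : rel T) (S : rel V)
    (e : T -> U) (m : U -> V) u v : transitive S ->
    (forall x y, R x y -> S (m (e x)) (m (e y))) ->
  clos_trans U (im_rel e R) u v -> S (m u) (m v).
Proof.
move=> trS RS; elim=> {u v} [u v|u v w _ uv _ vw]; last exact: trS uv vw.
by case/existsP=> x /existsP[y /and3P[xy /eqP-> /eqP->]]; apply: RS.
Qed.

(** A relation in [C] is pulled back along the inverse of [g], resolved into a chain in [B], and the
    chain is pushed forward by [g]. *)
Lemma generating_iso_comp (A B C : dposet) (g : dpmor B C) (f : dpmor A B) :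
  is_iso g -> generating f -> generating (dpcomp g f).
Proof.
case=> h [_ gh] [fP fQ].
have hK y : y = g (h y) by rewrite -dpcompE gh dpidE.
split=> x y xy; rewrite (hK x) (hK y);
  apply: (clos_trans_im_comp (dpcompE g f)).
- by apply/fP/dpmor_P.
- by apply/fQ/dpmor_Q.
Qed.

(** * Fill-ins *)

Lemma factor_surj (T U V : Type) (e : T -> U) (k : T -> V) :
    surjective e -> (forall x y, e x = e y -> k x = k y) ->
  {u : U -> V | forall x, u (e x) = k x}.
Proof.
move=> /choice[s es] ek; exists (fun y => k (s y)) => x.
by apply: ek; rewrite es.
Qed.

(** Injectivity of [m] makes [k] constant on the fibers of [e], which gives the diagonal as a map;
    it preserves the orders because [n] does and [m] reflects them. *)
Lemma epi_regmono_fill (A B C D : dposet) (e : dpmor A C) (k : dpmor A D)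
    (m : dpmor D B) (n : dpmor C B) :
    surjective e -> injective m -> reflecting m ->
    dpcomp n e = dpcomp m k ->
  exists2 u : dpmor C D, dpcomp u e = k & dpcomp m u = n.
Proof.
move=> se jm [rP rQ] /dpcomp_eq nemk.
have [x y exy|s sE] := factor_surj (k := k) se.
  by apply: jm; rewrite -!nemk exy.
have ms c : m (s c) = n c by case: (se c) => a <-; rewrite sE nemk.
have [u uE] : {u : dpmor C D | u =1 s}.
  apply: dpmor_of => x y xy; [apply: rP | apply: rQ]; rewrite !ms.
    exact: dpmor_P.
  exact: dpmor_Q.
by exists u; apply: dpmor_ext => x; rewrite dpcompE uE.
Qed.

Lemma factor_generating (A C D : dposet) (e : dpmor A C) (k : dpmor A D) :
    surjective e -> generating e -> (forall x y, e x = e y -> k x = k y) ->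
  exists u : dpmor C D, dpcomp u e = k.
Proof.
move=> se [gP gQ] ek; have [s sE] := factor_surj se ek.
have [u uE] : {u : dpmor C D | u =1 s}.
  apply: dpmor_of => x y xy.
    apply: clos_trans_im_sub (gP _ _ xy); first by case: (dpP_strict D).
    by move=> a b ab; rewrite !sE; apply: dpmor_P.
  apply: clos_trans_im_sub (gQ _ _ xy); first by case: (dpQ_strict D).
  by move=> a b ab; rewrite !sE; apply: dpmor_Q.
by exists u; apply: dpmor_ext => x; rewrite dpcompE uE.
Qed.

(** The diagonal map arises as in [epi_regmono_fill], but now the orders are handled on the side of
    [e]: those of [C] are generated from [A], where [k] preserves them. *)
Lemma regepi_mono_fill (A B C D : dposet) (e : dpmor A C) (k : dpmor A D)
    (m : dpmor D B) (n : dpmor C B) :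
    surjective e -> generating e -> injective m ->
    dpcomp n e = dpcomp m k ->
  exists2 u : dpmor C D, dpcomp u e = k & dpcomp m u = n.
Proof.
move=> se ge jm nemk; have E := dpcomp_eq nemk.
have [x y exy|u ue] := factor_generating (k := k) se ge.
  by apply: jm; rewrite -!E exy.
by exists u => //; apply: (surj_epi se); rewrite -dpcompA ue.
Qed.

(** * Special morphisms *)

Lemma strict_order0 (T : Type) : strict_order (fun _ _ : T => false).
Proof. by []. Qed.

(** Every map out of a discrete object is a morphism; the one-point case represents elements. *)
Definition discrete (T : finType) : dposet :=
  DPoset (@strict_order0 T) (@strict_order0 T).

Lemma monoP (A B : dposet) (f : dpmor A B) : is_mono f <-> injective f.
Proof.
split=> [mf x y fxy|]; last exact: inj_mono.
have [g gE] : {g : dpmor (discrete unit) A | g =1 fun=> x}.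
  by apply: dpmor_of.
have [h hE] : {h : dpmor (discrete unit) A | h =1 fun=> y}.
  by apply: dpmor_of.
rewrite -(gE tt) -(hE tt); congr (dpmor_apply _ _); apply: mf.
by apply: dpmor_ext => z; rewrite !dpcompE gE hE.
Qed.

(* [B] glued to itself along the image of [f], with the orders of [B] pulled
   back along the folding map. *)
Section CokernelPair.
Variables (A B : dposet) (f : dpmor A B).

Definition glue : finType := {p : B * bool | p.2 ==> (p.1 \notin codom f)}.

Definition glued : dposet := @DPoset glue
  (relpre (fun p : glue => (val p).1) (dpP B))
  (relpre (fun p : glue => (val p).1) (dpQ B))
  (strict_relpre _ (dpP_strict B)) (strict_relpre _ (dpQ_strict B)).

Definition glue_left (b : B) : glued :=
  exist (fun p : B * bool => p.2 ==> (p.1 \notin codom f)) (b, false) isT.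

Definition glue_right (b : B) : glued :=
  exist (fun p : B * bool => p.2 ==> (p.1 \notin codom f))
    (b, b \notin codom f) (implybb (b \notin codom f)).

(** Both copies of [b] fold back to [b], so both inclusions preserve the orders. The pair serves to
    test epimorphisms and to present regular monomorphisms as equalizers. *)
Lemma cokernel_pair : exists g h : dpmor B glued,
  forall b, g b = h b <-> b \in codom f.
Proof.
have [g gE] : {g : dpmor B glued | g =1 glue_left} by apply: dpmor_of.
have [h hE] : {h : dpmor B glued | h =1 glue_right} by apply: dpmor_of.
exists g, h => b; rewrite gE hE; split=> [[/esym/negbFE //]|bf].
by apply: val_inj; rewrite /= bf.
Qed.

End CokernelPair.

Lemma epiP (A B : dposet) (f : dpmor A B) : is_epi f <-> surjective f.
Proof.
split=> [ef y|]; last exact: surj_epi.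
have [g [h gh]] := cokernel_pair f.
have E : g = h.
  apply: ef; apply: dpmor_ext => x; rewrite !dpcompE.
  by apply/gh/codom_f.
have /codomP[x ->] : y \in codom f by apply/gh; rewrite E.
by exists x.
Qed.

(** * Factorization through the induced and the generated image *)

Section Images.
Variables (A B : dposet) (f : dpmor A B).

Definition corestr (a : A) : image_type f :=
  exist (fun b => b \in codom f) (f a) (codom_f f a).

Lemma image_induced_corestr :
  exists2 q : dpmor A (image_induced f), surjective q &
    forall a, val (q a) = f a.
Proof.
have [q qE] : {q : dpmor A (image_induced f) | q =1 corestr}.
  by apply: dpmor_of => x y; [exact: dpmor_P | exact: dpmor_Q].
exists q => [[y yf]|a]; last by rewrite qE.
by have /codomP[x yE] := yf; exists x; apply: val_inj; rewrite qE /= yE.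
Qed.

Lemma image_induced_incl :
  exists2 i : dpmor (image_induced f) B, injective i /\ reflecting i &
    forall y, i y = val y.
Proof.
have [i iE] : {i : dpmor (image_induced f) B | i =1 val}.
  by apply: dpmor_of.
exists i => //; split=> [x y|]; first by rewrite !iE; apply: val_inj.
by split=> x y; rewrite !iE.
Qed.

Lemma image_generated_corestr :
  exists2 q : dpmor A (image_generated f), surjective q /\ generating q &
    forall a, val (q a) = f a.
Proof.
have [q qE] : {q : dpmor A (image_generated f) | q =1 corestr}.
  by apply: dpmor_of => x y xy; apply/asboolP/t_step/existsP;
    exists x; apply/existsP; exists y; rewrite xy !eqxx.
have fE x : f x = val (q x) by rewrite qE.
exists q => //; split=> [[y yf]|].
  by have /codomP[x yE] := yf; exists x; apply: val_inj; rewrite -fE /= yE.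
by split=> x y /asboolP; apply: clos_trans_im_inj => //; apply: val_inj.
Qed.

Lemma image_generated_incl :
  exists2 i : dpmor (image_generated f) B, injective i &
    forall y, i y = val y.
Proof.
have [i iE] : {i : dpmor (image_generated f) B | i =1 val}.
  apply: dpmor_of => x y /asboolP xy.
    (* With [m] the identity, this says that the closure of the image relation lies in the order of
       [B]. *)
    apply: (clos_trans_im_sub (m := id)) xy; first by case: (dpP_strict B).
    by move=> *; apply: dpmor_P.
  apply: (clos_trans_im_sub (m := id)) xy; first by case: (dpQ_strict B).
  by move=> *; apply: dpmor_Q.
by exists i => // x y; rewrite !iE; apply: val_inj.
Qed.

End Images.

Lemma regmonoP (A B : dposet) (f : dpmor A B) :
  is_regmono f <-> injective f /\ reflecting f.
Proof.
split=> [[D [g [h [gfhf univ]]]]|[jf rf]].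
  have mf : is_mono f.
    move=> E a b ab; have [|u [_ uni]] := univ E (dpcomp f a).
      by rewrite !dpcompA gfhf.
    by rewrite -(uni a) // (uni b).
  have /monoP jf := mf; split=> //.
  have [q _ qE] := image_induced_corestr f.
  have [i [_ [iP iQ]] iE] := image_induced_incl f.
  have fE x : f x = i (q x) by rewrite iE qE.
  (* The inclusion [i] of the induced image also equalizes [g] and [h], so it factors through [f].
     The resulting [u] undoes [q] and carries the relations of [B] between values of [f] back to
     [A]. *)
  have [|u [fu _]] := univ _ i.
    apply: dpmor_ext => y; rewrite !dpcompE iE.
    by have /codomP[x ->] := valP y; apply: dpcomp_eq.
  have uq x : u (q x) = x by apply: jf; rewrite -dpcompE fu fE.
  by split=> x y; rewrite !fE; [move/iP/(dpmor_P u)|move/iQ/(dpmor_Q u)];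
    rewrite !uq.
(* Conversely, [f] is the equalizer of the two inclusions of [B] into the glued object. *)
have [g [h gh]] := cokernel_pair f.
exists (glued f), g, h; split.
  by apply: dpmor_ext => x; rewrite !dpcompE; apply/gh/codom_f.
move=> E k /dpcomp_eq gkhk.
have /choice[s sE] x : exists y, f y = k x.
  by have /gh/codomP[y ->] := gkhk x; exists y.
have [u uE] : {u : dpmor E A | u =1 s}.
  case: rf => rP rQ; apply: dpmor_of => x y xy;
    [apply: rP | apply: rQ]; rewrite !sE.
    exact: dpmor_P.
  exact: dpmor_Q.
have fu : dpcomp f u = k by apply: dpmor_ext => x; rewrite dpcompE uE.
by exists u; split=> // v fv; apply: (inj_mono jf); rewrite fu.
Qed.

Lemma regepiP (A B : dposet) (f : dpmor A B) :
  is_regepi f <-> surjective f /\ generating f.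
Proof.
split=> [[D [g [h [fgfh univ]]]]|[sf gf]].
  have ef : is_epi f.
    move=> E a b ab; have [|u [_ uni]] := univ E (dpcomp a f).
      by rewrite -!dpcompA fgfh.
    by rewrite -(uni a) // (uni b).
  have /epiP sf := ef; split=> //.
  have [q _ qE] := image_generated_corestr f.
  (* The corestriction [q] to the generated image coequalizes the pair too; the induced [u] is the
     identity on points, so each relation of [B] is a generated one. *)
  have [|u [uf _]] := univ _ q.
    apply: dpmor_ext => x; apply: val_inj.
    by rewrite !dpcompE !qE; apply: dpcomp_eq.
  have uE y : val (u y) = y.
    by case: (sf y) => x <-; rewrite -dpcompE uf qE.
  by split=> x y; [move/(dpmor_P u)/asboolP | move/(dpmor_Q u)/asboolP];
    rewrite !uE.
(* The kernel pair of [f] with empty orders: coequalizing its projections means being constant on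
   the fibers of [f]. *)
pose K : finType := {p : A * A | f p.1 == f p.2}.
have [g gE] : {g : dpmor (discrete K) A | g =1 fun p => (val p).1}.
  by apply: dpmor_of.
have [h hE] : {h : dpmor (discrete K) A | h =1 fun p => (val p).2}.
  by apply: dpmor_of.
exists (discrete K), g, h; split.
  by apply: dpmor_ext => p; rewrite !dpcompE gE hE; apply/eqP/(valP p).
move=> E k /dpcomp_eq kgkh.
have [x y /eqP fxy|u uf] := factor_generating (k := k) sf gf.
  have := kgkh (exist (fun p : A * A => f p.1 == f p.2) (x, y) fxy).
  by rewrite gE hE.
by exists u; split=> // v vf; apply: (surj_epi sf); rewrite uf.
Qed.

(** * Morphisms with a given image *)

Lemma image_inducedP (A B C : dposet) (f : dpmor A B) :
  dp_isomorphic (image_induced f) C <->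
  exists e : dpmor A C, exists m : dpmor C B,
    [/\ is_epi e, is_regmono m & dpcomp m e = f].
Proof.
split=> [[p ip]|[e [m [/epiP se /regmonoP[jm rm] <-]]]].
  have [q sq qE] := image_induced_corestr f.
  have [i [ji ri] iE] := image_induced_incl f.
  have [p' ip' [p'p _]] := iso_inverse ip.
  exists (dpcomp p q), (dpcomp i p'); split.
  - by apply/epiP/surjective_comp => //; apply: iso_surj.
  - apply/regmonoP; split; first by apply: injective_comp => //; apply: iso_inj.
    by apply: reflecting_comp => //; apply: iso_reflecting.
  - rewrite -dpcompA [dpcomp p' _]dpcompA p'p dpcomp1f.
    by apply: dpmor_ext => x; rewrite dpcompE iE.
have [q sq qE] := image_induced_corestr (dpcomp m e).
have [i [ji ri] iE] := image_induced_incl (dpcomp m e).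
have iq : dpcomp i q = dpcomp m e.
  by apply: dpmor_ext => x; rewrite dpcompE iE.
have [u uq mu] := epi_regmono_fill sq jm rm iq.
(* Surjectivity comes from [u \o q = e], injectivity and reflection from [m \o u = i]. *)
exists u; apply: bij_reflecting_iso.
- move=> c; case: (se c) => a <-; exists (q a).
  by rewrite -dpcompE uq.
- by move=> x y xy; apply: ji; rewrite -mu !dpcompE xy.
- case: ri => iP iQ.
  by split=> x y xy; [apply: iP | apply: iQ]; rewrite -mu !dpcompE;
    [apply: dpmor_P | apply: dpmor_Q].
Qed.

Lemma image_generatedP (A B C : dposet) (f : dpmor A B) :
  dp_isomorphic (image_generated f) C <->
  exists e : dpmor A C, exists m : dpmor C B,
    [/\ is_regepi e, is_mono m & dpcomp m e = f].
Proof.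
split=> [[p ip]|[e [m [/regepiP[se ge] /monoP jm <-]]]].
  have [q [sq gq] qE] := image_generated_corestr f.
  have [i ji iE] := image_generated_incl f.
  have [p' ip' [p'p _]] := iso_inverse ip.
  exists (dpcomp p q), (dpcomp i p'); split.
  - apply/regepiP; split; last exact: generating_iso_comp.
    by apply: surjective_comp => //; apply: iso_surj.
  - by apply/monoP/injective_comp => //; apply: iso_inj.
  - rewrite -dpcompA [dpcomp p' _]dpcompA p'p dpcomp1f.
    by apply: dpmor_ext => x; rewrite dpcompE iE.
have [q [sq gq] qE] := image_generated_corestr (dpcomp m e).
have [i ji iE] := image_generated_incl (dpcomp m e).
have iq : dpcomp i q = dpcomp m e.
  by apply: dpmor_ext => x; rewrite dpcompE iE.
(* Both factorizations are of the same kind, so fill-ins exist in both directions; cancelling [q]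
   and [e] shows that they are mutually inverse. *)
have [u uq mu] := regepi_mono_fill sq gq jm iq.
have [v ve iv] := regepi_mono_fill se ge ji (esym iq).
exists u, v; split.
- by apply: (surj_epi sq); rewrite -dpcompA uq ve dpcomp1f.
- by apply: (surj_epi se); rewrite -dpcompA ve uq dpcomp1f.
Qed.

(** * Counting *)

(** Stated for abstract classes [E] and [M] to cover both formulas: composition maps [E * M] onto
    [S], and each fiber is in bijection with [Aut C]. *)
Lemma card_factorizations (A B C : dposet) (S : {set dpmor A B})
    (E : {set dpmor A C}) (M : {set dpmor C B}) :
    {in E, forall e, is_epi e} ->
    (forall s e, is_iso s -> e \in E -> dpcomp s e \in E) ->
    (forall s m, is_iso s -> m \in M -> dpcomp m s \in M) ->
    (forall e k n m, e \in E -> k \in E -> n \in M -> m \in M ->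
      dpcomp n e = dpcomp m k ->
      exists2 s, dpcomp s e = k & dpcomp m s = n) ->
    (forall f, f \in S <->
      exists e m, [/\ e \in E, m \in M & dpcomp m e = f]) ->
  (#|E| * #|M| = #|S| * #|Aut C|)%N.
Proof.
move=> epiE EA MA fill inS.
pose comp (p : dpmor A C * dpmor C B) := dpcomp p.2 p.1.
rewrite -cardsX -sum1_card (partition_big comp (mem S)) /=; last first.
  by case=> e m /setXP[eE mM]; apply/inS; exists e, m.
rewrite -sum_nat_const; apply: eq_bigr => f /inS[e [m [eE mM fE]]].
(* The fiber over [m \o e] consists of the pairs [(s^-1 \o e, m \o s)]. *)
have /choice[inv invP] (s : dpmor C C) : exists t : dpmor C C,
    is_iso s -> [/\ is_iso t, dpcomp t s = dpid C & dpcomp s t = dpid C].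
  case: (pselect (is_iso s)) => [/iso_inverse[t it [ts st]]|ns].
    by exists t.
  (* A default value: [inv s] is constrained only when [s] is an isomorphism. *)
  by exists s.
pose act (s : dpmor C C) := (dpcomp (inv s) e, dpcomp m s).
(* The first component suffices: cancelling [e] gives equal inverses, hence [s = t]. *)
have act_inj : {in Aut C &, injective act}.
  move=> s t; rewrite !inE => /asboolP is_s /asboolP is_t.
  move/(congr1 fst)/(epiE _ eE) => inv_eq.
  case: (invP s is_s) => _ _ si; case: (invP t is_t) => _ ti _.
  by rewrite -(dpcompf1 s) -ti -inv_eq dpcompA si dpcomp1f.
rewrite -(card_in_imset act_inj) sum1_card; apply: eq_card => -[k n].
rewrite unfold_in /= -topredE /=.
apply/andP/imsetP => [[/setXP[kE nM] /eqP nk]|[s]].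
  (* Any other factorization is compared with [(e, m)] by fill-ins both ways, which are inverse to
     each other since [k] and [e] are epimorphisms. *)
  have nkme : dpcomp n k = dpcomp m e by rewrite fE.
  have [s sk ms] := fill _ _ _ _ kE eE nM mM nkme.
  have [t te nt] := fill _ _ _ _ eE kE mM nM (esym nkme).
  have ts : dpcomp t s = dpid C.
    by apply: (epiE _ kE); rewrite -dpcompA sk te dpcomp1f.
  have st : dpcomp s t = dpid C.
    by apply: (epiE _ eE); rewrite -dpcompA te sk dpcomp1f.
  have is_s : is_iso s by exists t.
  exists s; first by rewrite inE; apply/asboolP.
  case: (invP s is_s) => _ is1 _; congr pair; last by rewrite ms.
  by rewrite -sk dpcompA is1 dpcomp1f.
rewrite inE => /asboolP is_s [-> ->]; case: (invP s is_s) => it _ st.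
split; first by apply/setXP; split; [apply: EA | apply: MA].
by rewrite /comp /= -dpcompA [dpcomp s _]dpcompA st dpcomp1f fE.
Qed.

Lemma card_Aut_neq0 (C : dposet) : #|Aut C|%:R != 0 :> rat.
Proof.
rewrite Num.Theory.pnatr_eq0 -lt0n; apply/card_gt0P; exists (dpid C).
by rewrite inE; apply/asboolP/dpid_iso.
Qed.

Theorem theoremB12 (A B C : dposet) :
  (#|[set f : dpmor A B | `[< dp_isomorphic (image_induced f) C >]]|%:R
     = (#|Epi A C|%:R * #|RegMono C B|%:R) / #|Aut C|%:R :> rat)
  /\
  (#|[set f : dpmor A B | `[< dp_isomorphic (image_generated f) C >]]|%:R
     = (#|RegEpi A C|%:R * #|Mono C B|%:R) / #|Aut C|%:R :> rat).
Proof.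
(* Clearing the nonzero denominator leaves identities in [nat]. The goals are the five hypotheses of
   [card_factorizations], first for (Epi, RegMono), then for (RegEpi, Mono). *)
split; apply: (canRL (mulfK (card_Aut_neq0 C))); rewrite -!natrM;
  congr (_%:R); symmetry; apply: card_factorizations.
- by move=> e; rewrite inE => /asboolP.
- move=> s e is_s; rewrite !inE => /asboolP/epiP se.
  by apply/asboolP/epiP/surjective_comp => //; apply: iso_surj.
- move=> s m is_s; rewrite !inE => /asboolP/regmonoP[jm rm].
  apply/asboolP/regmonoP; split.
    by apply: injective_comp => //; apply: iso_inj.
  by apply: reflecting_comp => //; apply: iso_reflecting.
- move=> e k n m; rewrite !inE => /asboolP/epiP se _ _.
  by move=> /asboolP/regmonoP[jm rm]; apply: epi_regmono_fill.
- move=> f; rewrite inE; split.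
    move/asboolP/image_inducedP=> [e [m [ee mm fE]]].
    by exists e, m; rewrite !inE; split=> //; apply/asboolP.
  case=> e [m []]; rewrite !inE => /asboolP ee /asboolP mm fE.
  by apply/asboolP/image_inducedP; exists e, m.
- by move=> e; rewrite inE => /asboolP/regepiP[/surj_epi].
- move=> s e is_s; rewrite !inE => /asboolP/regepiP[se ge].
  apply/asboolP/regepiP; split; last exact: generating_iso_comp.
  by apply: surjective_comp => //; apply: iso_surj.
- move=> s m is_s; rewrite !inE => /asboolP/monoP jm.
  by apply/asboolP/monoP/injective_comp => //; apply: iso_inj.
- move=> e k n m; rewrite !inE => /asboolP/regepiP[se ge] _ _.
  by move=> /asboolP/monoP jm; apply: regepi_mono_fill.
- move=> f; rewrite inE; split.
    move/asboolP/image_generatedP=> [e [m [ee mm fE]]].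
    by exists e, m; rewrite !inE; split=> //; apply/asboolP.
  case=> e [m []]; rewrite !inE => /asboolP ee /asboolP mm fE.
  by apply/asboolP/image_generatedP; exists e, m.
Qed.
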